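(* Let $k$ be a field and $N\ge 1$. Let $\mathbf{C}_N$ be the category of $N$-coverings of $k$-algebras, and let $\mathbf{F}_N$ be the category of flabby sheaves of $k$-algebras over the space $\mathbb{P}^{N-1}(\mathbb{Z}/2)$. Then the assignments $$F:\ \mathbf{C}_N\ni \{\pi_i : P \rightarrow P_i\}_i \longmapsto \Big(\mathcal{P} : U \mapsto P\big/R\big(L(U)\big)\Big) \in \mathbf{F}_N,$$ $$G:\ \mathbf{F}_N \ni \mathcal{P} \longmapsto \{\mathcal{P}(\mathbb{P}^{N-1}(\mathbb{Z}/2)) \rightarrow \mathcal{P}(A_i)\}_{i=1,\ldots,N} \in \mathbf{C}_N$$ (where $G$ uses the restriction maps of $\mathcal P$, and in the definition of $F$ the restriction maps are the canonical quotient maps) yield an equivalence of categories. Here, for open $U\subseteq \mathbb{P}^{N-1}(\mathbb{Z}/2)$, $L(U)$ is the set of inclusion-minimal elements of $\{u\subseteq\{1,\ldots,N\}\mid u\ne\emptyset,\ \bigcap_{i\in u}A_i\subseteq U\}$, and for a set $l$ of nonempty subsets of $\{1,\ldots,N\}$, $R(l)$ is the ideal $\bigcap_{u\in l}\big(\sum_{i\in u}\ker\pi_i\big)$ of $P$.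
   Context: Algebras are unital associative algebras over a field $k$, the zero algebra being allowed; homomorphisms are unital. The space $\mathbb{P}^{N-1}(\mathbb{Z}/2)$ is the set $\{0,1\}^N\setminus\{(0,\ldots,0)\}$ with the topology generated by (i.e. having as a subbasis) the subsets $A_i:=\{(z_1,\ldots,z_N)\mid z_i\neq 0\}$, $i=1,\ldots,N$. An $N$-covering of an algebra $P$ is a family $\{\pi_i:P\to P_i\}_{i=1,\ldots,N}$ of surjective algebra homomorphisms such that $\bigcap_{i=1}^N\ker\pi_i=\{0\}$ and the lattice of ideals of $P$ generated by $\ker\pi_1,\ldots,\ker\pi_N$ (with lattice operations $+$ and $\cap$) is distributive. A morphism in $\mathbf{C}_N$ from $\{\pi_i : P \rightarrow P_i\}_i$ to $\{\eta_i : Q \rightarrow Q_i\}_i$ consists of algebra homomorphisms $\xi : P \rightarrow Q$ and $\xi_i : P_i \rightarrow Q_i$ such that $\eta_i \circ \xi = \xi_i \circ \pi_i$ for all $i\in\{1,\ldots,N\}$. The functor $F$ sends such a morphism to the morphism of sheaves induced by $\xi$ on the quotients; the functor $G$ sends a morphism of sheaves to its components on $\mathbb{P}^{N-1}(\mathbb{Z}/2)$ and on $A_1,\ldots,A_N$. A sheaf $\mathcal{P}$ is flabby if for all open $V\subseteq U$ the restriction map $\mathcal{P}(U)\to\mathcal{P}(V)$ is surjective. Morphisms in $\mathbf{F}_N$ are morphisms of sheaves of algebras. The empty intersection of ideals of $P$ is $P$ itself (so that $U=\emptyset$ yields the zero algebra). *)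

(* Defs.v *)
From HB Require Import structures.
From mathcomp Require Import all_boot all_algebra finmap.
From mathcomp Require Import all_classical topology.

Set Implicit Arguments.
Unset Strict Implicit.
Unset Printing Implicit Defensive.

Import GRing.Theory.

Local Open Scope classical_set_scope.
Local Open Scope ring_scope.
Local Open Scope quotient_scope.

(* MathComp's [algType] requires 1 <> 0, which excludes the zero algebra; the
   structure below is [algType] over [pzRingType].  The scaling is a field of
   the mixin because the hierarchy does not admit a second join of [pzRingType]
   and [lmodType] besides [lalgType]. *)
HB.mixin Record PzRing_isPzAlgebra (k : pzRingType) A of GRing.PzRing A := {
  ascale : k -> A -> A;
  ascalerA : forall a b x, ascale a (ascale b x) = ascale (a * b) x;
  ascale1r : left_id 1 ascale;
  ascalerDr : right_distributive ascale +%R;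
  ascalerDl : forall x, {morph ascale^~ x : a b / a + b};
  ascalerAl : forall a (x y : A), ascale a (x * y) = ascale a x * y;
  ascalerAr : forall a (x y : A), ascale a (x * y) = x * ascale a y
}.

#[short(type="pzAlgType")]
HB.structure Definition PzAlgebra (k : pzRingType) :=
  {A of PzRing_isPzAlgebra k A & GRing.PzRing A}.

Section AlgebraMorphisms.
Variable k : pzRingType.

Record algHom (A B : pzAlgType k) := AlgHom {
  alg_fun :> A -> B;
  algHomB : zmod_morphism alg_fun;
  algHomM : monoid_morphism alg_fun;
  algHomZ : forall (c : k) x, alg_fun (ascale c x) = ascale c (alg_fun x)
}.

HB.instance Definition _ A B (f : algHom A B) :=
  GRing.isZmodMorphism.Build A B f (algHomB f).
HB.instance Definition _ A B (f : algHom A B) :=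
  GRing.isMonoidMorphism.Build A B f (algHomM f).

Lemma algHom_ext (A B : pzAlgType k) (f g : algHom A B) : f =1 g -> f = g.
Proof.
case: f g => [f fB fM fZ] [g gB gM gZ] /= /funext fg.
by case: g / fg gB gM gZ => gB gM gZ; congr AlgHom; exact: Prop_irrelevance.
Qed.

Program Definition idAlg (A : pzAlgType k) : algHom A A := @AlgHom A A id _ _ _.
Solve All Obligations with by [].

Program Definition compAlg (A B C : pzAlgType k) (g : algHom B C)
  (f : algHom A B) : algHom A C := @AlgHom A C (g \o f) _ _ _.
Next Obligation. by move=> A B C g f x y /=; rewrite !rmorphB. Qed.
Next Obligation.
by move=> A B C g f; split=> [|x y] /=; rewrite ?rmorph1 ?rmorphM.
Qed.
Next Obligation. by move=> A B C g f c x /=; rewrite !algHomZ. Qed.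

End AlgebraMorphisms.

Section Ideals.
Variable k : pzRingType.

(* A two-sided ideal of a unital algebra is stable under negation and scaling,
   since - x = (- 1) * x and c x = (c 1) * x. *)
Definition is_ideal (A : pzAlgType k) (I : set A) :=
  [/\ I 0, forall x y, I x -> I y -> I (x + y),
      forall a x, I x -> I (a * x) & forall a x, I x -> I (x * a)].

Record ideal (A : pzAlgType k) := Ideal {
  ideal_set :> A -> Prop;
  idealP : is_ideal ideal_set
}.

Section Theory.
Variables (A : pzAlgType k) (I : ideal A).

Lemma ideal0 : I 0. Proof. by case: (idealP I). Qed.

Lemma idealD x y : I x -> I y -> I (x + y).
Proof. by case: (idealP I) => _ h _ _; exact: h. Qed.

Lemma idealMl a x : I x -> I (a * x).
Proof. by case: (idealP I) => _ _ h _; exact: h. Qed.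

Lemma idealMr a x : I x -> I (x * a).
Proof. by case: (idealP I) => _ _ _ h; exact: h. Qed.

Lemma idealN x : I x -> I (- x).
Proof. by move=> Ix; rewrite -mulN1r; exact: idealMl. Qed.

Lemma idealZ (c : k) x : I x -> I (ascale c x).
Proof. by move=> Ix; rewrite -[x]mul1r ascalerAl; exact: idealMl. Qed.

End Theory.

Program Definition ker_ideal (A B : pzAlgType k) (f : algHom A B) : ideal A :=
  @Ideal A [set x | f x = 0] _.
Next Obligation.
move=> A B f; split=> [|x y /= fx fy|a x /= fx|a x /= fx].
- by rewrite /= rmorph0.
- by rewrite /= rmorphD /= fx fy addr0.
- by rewrite /= rmorphM /= fx mulr0.
- by rewrite /= rmorphM /= fx mul0r.
Qed.

Program Definition sum_ideal (A : pzAlgType k) (J : finType)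
    (I_ : J -> ideal A) (u : {set J}) : ideal A :=
  @Ideal A [set x | exists2 y : J -> A,
    (forall i, i \in u -> I_ i (y i)) & x = \sum_(i in u) y i] _.
Next Obligation.
move=> A J I_ u; split=> [|_ _ [y Iy ->] [z Iz ->]|a _ [y Iy ->]|a _ [y Iy ->]].
- by exists (fun=> 0) => [i _|]; [exact: ideal0 | rewrite big1].
- exists (fun i => y i + z i) => [i iu|]; last by rewrite big_split.
  by apply: idealD; [exact: Iy | exact: Iz].
- exists (fun i => a * y i) => [i iu|]; last by rewrite mulr_sumr.
  by apply: idealMl; exact: Iy.
- exists (fun i => y i * a) => [i iu|]; last by rewrite mulr_suml.
  by apply: idealMr; exact: Iy.
Qed.

Program Definition bigcap_ideal (A : pzAlgType k) (J : finType)
    (I_ : J -> ideal A) (l : {set J}) : ideal A :=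
  @Ideal A (\bigcap_(u in [set` l]) I_ u) _.
Next Obligation.
move=> A J I_ l; split=> [u _|x y Ix Iy u ul|a x Ix u ul|a x Ix u ul].
- exact: ideal0.
- by apply: idealD; [exact: Ix | exact: Iy].
- by apply: idealMl; exact: Ix.
- by apply: idealMr; exact: Ix.
Qed.

End Ideals.

Section Quotient.
Variables (k : pzRingType) (A : pzAlgType k) (I : ideal A).

Definition ideal_rel : rel A := fun x y => `[< I (x - y) >].

Lemma ideal_rel_equiv : equiv_class_of ideal_rel.
Proof.
split=> [x|x y|y x z].
- by apply/asboolP; rewrite subrr; exact: ideal0.
- by apply/asboolP/asboolP => /idealN; rewrite opprB.
- by move=> /asboolP Ixy /asboolP Iyz; apply/asboolP; rewrite -(subrKA y);
     exact: idealD.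
Qed.

Canonical ideal_rel_equiv_rel := EquivRelPack ideal_rel_equiv.

Definition quot := {eq_quot ideal_rel}.

HB.instance Definition _ : EqQuotient A ideal_rel quot := EqQuotient.on quot.
HB.instance Definition _ := Choice.on quot.

Lemma quot_eqP (x y : A) : \pi_quot x = \pi_quot y <-> I (x - y).
Proof.
split=> [/eqP|Ixy]; first by rewrite eqmodE => /asboolP.
by apply/eqP; rewrite eqmodE; exact/asboolP.
Qed.

Definition quot_zero : quot := \pi_quot 0.
Definition quot_one : quot := \pi_quot 1.
Definition quot_opp (x : quot) : quot := \pi_quot (- repr x).
Definition quot_add (x y : quot) : quot := \pi_quot (repr x + repr y).
Definition quot_mul (x y : quot) : quot := \pi_quot (repr x * repr y).
Definition quot_scale (c : k) (x : quot) : quot := \pi_quot (ascale c (repr x)).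

Lemma repr_piP (x : A) : I (repr (\pi_quot x) - x).
Proof. by apply/quot_eqP; rewrite reprK. Qed.

Lemma quot_oppE x : quot_opp (\pi_quot x) = \pi_quot (- x).
Proof.
by apply/quot_eqP; rewrite -opprD; apply: idealN; exact: repr_piP.
Qed.

Lemma quot_addE x y :
  quot_add (\pi_quot x) (\pi_quot y) = \pi_quot (x + y).
Proof.
by apply/quot_eqP; rewrite opprD addrACA; apply: idealD; exact: repr_piP.
Qed.

Lemma quot_mulE x y :
  quot_mul (\pi_quot x) (\pi_quot y) = \pi_quot (x * y).
Proof.
apply/quot_eqP; rewrite -(subrKA (x * repr (\pi_quot y))) -mulrBl -mulrBr.
by apply: idealD; [apply: idealMr|apply: idealMl]; exact: repr_piP.
Qed.

Lemma ascalerN (c : k) (x : A) : ascale c (- x) = - ascale c x.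
Proof.
apply/eqP; rewrite -addr_eq0 -ascalerDr addNr.
by apply/eqP/(addrI (ascale c 0)); rewrite -ascalerDr !addr0.
Qed.

Lemma quot_scaleE c x : quot_scale c (\pi_quot x) = \pi_quot (ascale c x).
Proof.
by apply/quot_eqP; rewrite -ascalerN -ascalerDr; apply: idealZ; exact: repr_piP.
Qed.

Lemma quot_ind (P : quot -> Prop) : (forall x, P (\pi_quot x)) -> forall x, P x.
Proof. by move=> h x; rewrite -[x]reprK. Qed.

Fact quot_addA : associative quot_add.
Proof.
by elim/quot_ind=> x; elim/quot_ind=> y; elim/quot_ind=> z;
   rewrite !quot_addE addrA.
Qed.

Fact quot_addC : commutative quot_add.
Proof.
by elim/quot_ind=> x; elim/quot_ind=> y; rewrite !quot_addE addrC.
Qed.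

Fact quot_add0 : left_id quot_zero quot_add.
Proof. by elim/quot_ind=> x; rewrite quot_addE add0r. Qed.

Fact quot_addN : left_inverse quot_zero quot_opp quot_add.
Proof. by elim/quot_ind=> x; rewrite quot_oppE quot_addE addNr. Qed.

HB.instance Definition _ :=
  GRing.isZmodule.Build quot quot_addA quot_addC quot_add0 quot_addN.

Lemma quotD x y : \pi_quot x + \pi_quot y = \pi_quot (x + y).
Proof. exact: quot_addE. Qed.

Lemma quotN x : - \pi_quot x = \pi_quot (- x).
Proof. exact: quot_oppE. Qed.

Fact quot_mulA : associative quot_mul.
Proof.
by elim/quot_ind=> x; elim/quot_ind=> y; elim/quot_ind=> z;
   rewrite !quot_mulE mulrA.
Qed.

Fact quot_mul1l : left_id quot_one quot_mul.
Proof. by elim/quot_ind=> x; rewrite quot_mulE mul1r. Qed.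

Fact quot_mul1r : right_id quot_one quot_mul.
Proof. by elim/quot_ind=> x; rewrite quot_mulE mulr1. Qed.

Fact quot_mulDl : left_distributive quot_mul +%R.
Proof.
by elim/quot_ind=> x; elim/quot_ind=> y; elim/quot_ind=> z;
   rewrite quotD !quot_mulE quotD mulrDl.
Qed.

Fact quot_mulDr : right_distributive quot_mul +%R.
Proof.
by elim/quot_ind=> x; elim/quot_ind=> y; elim/quot_ind=> z;
   rewrite quotD !quot_mulE quotD mulrDr.
Qed.

HB.instance Definition _ := GRing.Zmodule_isPzRing.Build quot
  quot_mulA quot_mul1l quot_mul1r quot_mulDl quot_mulDr.

Lemma quotM x y : \pi_quot x * \pi_quot y = \pi_quot (x * y).
Proof. exact: quot_mulE. Qed.

Fact quot_scaleA a b x : quot_scale a (quot_scale b x) = quot_scale (a * b) x.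
Proof. by elim/quot_ind: x => x; rewrite !quot_scaleE ascalerA. Qed.

Fact quot_scale1 : left_id 1 quot_scale.
Proof. by elim/quot_ind=> x; rewrite quot_scaleE ascale1r. Qed.

Fact quot_scaleDr : right_distributive quot_scale +%R.
Proof.
by move=> c; elim/quot_ind=> x; elim/quot_ind=> y;
   rewrite quotD !quot_scaleE quotD ascalerDr.
Qed.

Fact quot_scaleDl x : {morph quot_scale^~ x : a b / a + b}.
Proof.
by elim/quot_ind: x => x a b; rewrite !quot_scaleE quotD ascalerDl.
Qed.

Fact quot_scaleAl a (x y : quot) : quot_scale a (x * y) = quot_scale a x * y.
Proof.
by elim/quot_ind: x => x; elim/quot_ind: y => y;
   rewrite quotM !quot_scaleE quotM ascalerAl.
Qed.

Fact quot_scaleAr a (x y : quot) : quot_scale a (x * y) = x * quot_scale a y.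
Proof.
by elim/quot_ind: x => x; elim/quot_ind: y => y;
   rewrite quotM !quot_scaleE quotM ascalerAr.
Qed.

HB.instance Definition _ := PzRing_isPzAlgebra.Build k quot
  quot_scaleA quot_scale1 quot_scaleDr quot_scaleDl quot_scaleAl quot_scaleAr.

Lemma quotZ (c : k) x : ascale c (\pi_quot x) = \pi_quot (ascale c x).
Proof. exact: quot_scaleE. Qed.

End Quotient.

Section QuotientMap.
Variables (k : pzRingType) (A B : pzAlgType k) (I : ideal A) (J : ideal B).
Variables (f : algHom A B) (fIJ : forall x, I x -> J (f x)).

Definition quot_map_fun (x : quot I) : quot J := \pi_(quot J) (f (repr x)).

Lemma quot_map_funE x : quot_map_fun (\pi_(quot I) x) = \pi_(quot J) (f x).
Proof.
by apply/quot_eqP; rewrite -rmorphB; apply: fIJ; exact: repr_piP.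
Qed.

Fact quot_map_additive : zmod_morphism quot_map_fun.
Proof.
elim/quot_ind=> x; elim/quot_ind=> y.
by rewrite quotN quotD !quot_map_funE quotN
           quotD rmorphB.
Qed.

Fact quot_map_multiplicative : monoid_morphism quot_map_fun.
Proof.
split; first by rewrite quot_map_funE rmorph1.
elim/quot_ind=> x; elim/quot_ind=> y.
by rewrite quotM !quot_map_funE quotM rmorphM.
Qed.

Fact quot_map_scalable (c : k) x :
  quot_map_fun (ascale c x) = ascale c (quot_map_fun x).
Proof.
elim/quot_ind: x => x.
by rewrite quotZ !quot_map_funE quotZ algHomZ.
Qed.

Definition quot_map : algHom (quot I : pzAlgType k) (quot J : pzAlgType k) :=
  AlgHom quot_map_additive quot_map_multiplicative quot_map_scalable.

Lemma quot_mapE x : quot_map (\pi_(quot I) x) = \pi_(quot J) (f x).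
Proof. exact: quot_map_funE. Qed.

End QuotientMap.

Record category := Category {
  obj :> Type;
  hom : obj -> obj -> Type;
  idm : forall X, hom X X;
  comp : forall X Y Z, hom Y Z -> hom X Y -> hom X Z;
  comp1m : forall X Y (f : hom X Y), comp (idm Y) f = f;
  compm1 : forall X Y (f : hom X Y), comp f (idm X) = f;
  compA : forall X Y Z T (h : hom Z T) (g : hom Y Z) (f : hom X Y),
    comp h (comp g f) = comp (comp h g) f
}.
Arguments hom {c} X Y.
Arguments idm {c} X.
Arguments comp {c X Y Z} g f.

Record functor (C D : category) := Functor {
  fobj :> C -> D;
  fmap : forall X Y : C, hom X Y -> hom (fobj X) (fobj Y);
  fmap1 : forall X, fmap (idm X) = idm (fobj X);
  fmap_comp : forall X Y Z (g : hom Y Z) (f : hom X Y),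
    fmap (comp g f) = comp (fmap g) (fmap f)
}.
Arguments fmap {C D} F {X Y} f : rename.

Record nattrans (C D : category) (F G : functor C D) := NatTrans {
  ntapp :> forall X : C, hom (F X) (G X);
  ntapp_nat : forall (X Y : C) (f : hom X Y),
    comp (ntapp Y) (fmap F f) = comp (fmap G f) (ntapp X)
}.

Program Definition opC (C : category) : category :=
  @Category C (fun X Y => @hom C Y X) (@idm C) (fun X Y Z g f => comp f g) _ _ _.
Next Obligation. by move=> C X Y f; exact: compm1. Qed.
Next Obligation. by move=> C X Y f; exact: comp1m. Qed.
Next Obligation. by move=> C X Y Z T h g f; exact/esym/compA. Qed.

Program Definition idF (C : category) : functor C C :=
  @Functor C C id (fun _ _ f => f) _ _.
Solve All Obligations with by [].

Program Definition compF (C D E : category) (G : functor D E)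
    (F : functor C D) : functor C E :=
  @Functor C E (fun X => G (F X)) (fun _ _ f => fmap G (fmap F f)) _ _.
Next Obligation. by move=> C D E G F X /=; rewrite !fmap1. Qed.
Next Obligation. by move=> C D E G F X Y Z g f /=; rewrite !fmap_comp. Qed.

Lemma nattrans_ext (C D : category) (F G : functor C D) (s t : nattrans F G) :
  (forall X, s X = t X) -> s = t.
Proof.
case: s t => [s sN] [t tN] /= st.
have {}st : s = t by apply: functional_extensionality_dep.
by case: t / st tN => tN; congr NatTrans; exact: Prop_irrelevance.
Qed.

Section FunctorCategory.
Variables C D : category.

Program Definition idN (F : functor C D) : nattrans F F :=
  @NatTrans C D F F (fun X => idm (F X)) _.
Next Obligation. by move=> F X Y f; rewrite comp1m compm1. Qed.

Program Definition compN (F G H : functor C D) (t : nattrans G H)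
    (s : nattrans F G) : nattrans F H :=
  @NatTrans C D F H (fun X => comp (t X) (s X)) _.
Next Obligation.
by move=> F G H t s X Y f; rewrite -compA ntapp_nat compA ntapp_nat -compA.
Qed.

Program Definition functorC : category :=
  @Category (functor C D) (@nattrans C D) idN compN _ _ _.
Next Obligation. by move=> F G s; apply: nattrans_ext => X; exact: comp1m. Qed.
Next Obligation. by move=> F G s; apply: nattrans_ext => X; exact: compm1. Qed.
Next Obligation.
by move=> F G H K u t s; apply: nattrans_ext => X; exact: compA.
Qed.

End FunctorCategory.

Definition is_iso (C : category) (X Y : C) (f : hom X Y) :=
  exists g : hom Y X, comp g f = idm X /\ comp f g = idm Y.

Definition nat_isomorphic (C D : category) (F G : functor C D) :=
  exists s : nattrans F G, forall X, is_iso (s X).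

(* [F] is an equivalence of categories with quasi-inverse [G]. *)
Definition inverse_equivalences (C D : category) (F : functor C D)
    (G : functor D C) :=
  nat_isomorphic (idF C) (compF G F) /\ nat_isomorphic (compF F G) (idF D).

Program Definition fullsub (C : category) (P : C -> Prop) : category :=
  @Category {X : C | P X} (fun X Y => hom (sval X) (sval Y))
    (fun X => idm (sval X)) (fun _ _ _ g f => comp g f) _ _ _.
Next Obligation. by move=> C P X Y f; exact: comp1m. Qed.
Next Obligation. by move=> C P X Y f; exact: compm1. Qed.
Next Obligation. by move=> C P X Y Z T h g f; exact: compA. Qed.

Program Definition restrictF (C D : category) (F : functor C D)
    (P : C -> Prop) (Q : D -> Prop) (PQ : forall X, P X -> Q (F X)) :
    functor (fullsub P) (fullsub Q) :=
  @Functor (fullsub P) (fullsub Q)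
    (fun X => exist Q (F (sval X)) (PQ _ (svalP X)))
    (fun X Y f => fmap F f) _ _.
Next Obligation. by move=> C D F P Q PQ X; exact: fmap1. Qed.
Next Obligation. by move=> C D F P Q PQ X Y Z g f; exact: fmap_comp. Qed.

Program Definition algC (k : pzRingType) : category :=
  @Category (pzAlgType k) (@algHom k) (@idAlg k) (@compAlg k) _ _ _.
Next Obligation. by move=> k A B f; exact: algHom_ext. Qed.
Next Obligation. by move=> k A B f; exact: algHom_ext. Qed.
Next Obligation. by move=> k A B C D h g f; exact: algHom_ext. Qed.

Section Presheaves.
Variables (k : pzRingType) (T : topologicalType).

Record opens := Opens { open_set :> set T; openP : open open_set }.

Program Definition opensC : category :=
  @Category opens (fun V U => V `<=` U) (fun U => @subset_refl T U)
    (fun W V U VU WV => subset_trans WV VU) _ _ _.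
Next Obligation. by move=> V U h; exact: Prop_irrelevance. Qed.
Next Obligation. by move=> V U h; exact: Prop_irrelevance. Qed.
Next Obligation. by move=> X W V U g f h; exact: Prop_irrelevance. Qed.

Definition opensT : opens := Opens openT.

Definition opensI (U V : opens) : opens := Opens (openI (openP U) (openP V)).

Definition presheafC : category := functorC (opC opensC) (algC k).

Definition res (S : presheafC) (U V : opens) (VU : V `<=` U) :
    algHom (S U) (S V) :=
  @fmap (opC opensC) (algC k) S U V VU.

Definition is_sheaf (S : presheafC) :=
  forall (U : opens) (J : Type) (V : J -> opens) (VU : forall j, V j `<=` U),
  U `<=` \bigcup_j V j ->
  forall s : forall j, S (V j),
  (forall i j, res S (@subIsetl T (V i) (V j) : opensI (V i) (V j) `<=` V i) (s i)
     = res S (@subIsetr T (V i) (V j) : opensI (V i) (V j) `<=` V j) (s j)) ->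
  exists! x : S U, forall j, res S (VU j) x = s j.

Definition is_flabby (S : presheafC) :=
  forall (U V : opens) (VU : V `<=` U), set_surj [set: S U] [set: S V] (res S VU).

Definition is_flabby_sheaf (S : presheafC) := is_sheaf S /\ is_flabby S.

End Presheaves.

(* The projective space P^(N-1)(Z/2): the group of units of Z/2 being trivial,
   its points are the non-zero vectors, with [true] standing for 1. *)
Definition projZ2 (N : nat) := {z : {ffun 'I_N -> bool} | z != [ffun=> false]}.

Definition chart (N : nat) (i : 'I_N) : set (projZ2 N) := [set z : projZ2 N | sval z i].

HB.instance Definition _ N := Choice.on (projZ2 N).
(* The index type of a subbase must be pointed, which ['I_N] is not, so the
   subbase is indexed by its own members. *)
HB.instance Definition _ N :=
  isSubBaseTopological.Build (projZ2 N) (range (@chart N)) id.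

Section Coverings.
Variables (k : fieldType) (N : nat).

(* The functors of the equivalence are defined on all families of algebra
   homomorphisms and on all presheaves of algebras, where they need no
   hypothesis; that they restrict to coverings and to flabby sheaves, which are
   full subcategories, is part of the theorem and not of the definitions. *)
Record family := Family {
  total : pzAlgType k;
  part : 'I_N -> pzAlgType k;
  proj : forall i, algHom total (part i)
}.

Record familyHom (X Y : family) := FamilyHom {
  totalHom : algHom (total X) (total Y);
  partHom : forall i, algHom (part X i) (part Y i);
  familyHomP : forall i x, proj Y i (totalHom x) = partHom i (proj X i x)
}.

Lemma familyHom_ext X Y (f g : familyHom X Y) :
  totalHom f = totalHom g -> (forall i, partHom f i = partHom g i) -> f = g.
Proof.
case: f g => [f fi fP] [g gi gP] /= fg figi.
have {}figi : fi = gi by apply: functional_extensionality_dep.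
case: g / fg gP => gP; case: gi / figi gP => gP.
by congr FamilyHom; exact: Prop_irrelevance.
Qed.

Program Definition familyC : category :=
  @Category family familyHom
    (fun X => @FamilyHom X X (idAlg _) (fun=> idAlg _) _)
    (fun X Y Z g f => @FamilyHom X Z (compAlg (totalHom g) (totalHom f))
       (fun i => compAlg (partHom g i) (partHom f i)) _) _ _ _.
Next Obligation. by []. Qed.
Next Obligation. by move=> X Y Z g f i x /=; rewrite !familyHomP. Qed.
Next Obligation.
by move=> X Y f; apply: familyHom_ext => [|i]; exact: algHom_ext.
Qed.
Next Obligation.
by move=> X Y f; apply: familyHom_ext => [|i]; exact: algHom_ext.
Qed.
Next Obligation.
by move=> X Y Z T h g f; apply: familyHom_ext => [|i]; exact: algHom_ext.
Qed.

Definition proj_ker (X : family) (i : 'I_N) : ideal (total X) :=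
  ker_ideal (proj X i).

Definition add_ideals (A : pzAlgType k) (I J : set A) : set A :=
  [set x + y | x in I & y in J].

Definition sublattice (A : pzAlgType k) (L : set (set A)) :=
  forall I J, L I -> L J -> L (add_ideals I J) /\ L (I `&` J).

Definition ker_lattice (X : family) : set (set (total X)) :=
  smallest (@sublattice (total X)) (range (fun i => proj_ker X i : set _)).

Definition distributive_lattice (A : pzAlgType k) (L : set (set A)) :=
  forall I J K, L I -> L J -> L K ->
    I `&` add_ideals J K = add_ideals (I `&` J) (I `&` K).

Definition is_covering (X : family) :=
  [/\ forall i, set_surj [set: total X] [set: part X i] (proj X i),
      \bigcap_i (proj_ker X i : set _) = [set 0]
    & distributive_lattice (@ker_lattice X)].

Definition openL (U : set (projZ2 N)) : {set {set 'I_N}} :=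
  [set u | minset (fun w : {set 'I_N} => (w != finset.set0) &&
                     `[< \bigcap_(i in [set` w]) chart i `<=` U >]) u]%SET.

Definition idealR (X : family) (l : {set {set 'I_N}}) : ideal (total X) :=
  bigcap_ideal (sum_ideal (proj_ker X)) l.

Lemma idealR_subset (X : family) (U V : set (projZ2 N)) : V `<=` U ->
  forall x, idealR X (openL U) x -> idealR X (openL V) x.
Proof.
move=> VU x Ux w; rewrite /= inE => /minsetp /andP[w0 /asboolP wV].
have [|u uU uw] := @minset_exists _ (fun w : {set 'I_N} => (w != finset.set0) &&
    `[< \bigcap_(i in [set` w]) chart i `<=` U >]) w.
  by apply/andP; split=> //; apply/asboolP; exact: subset_trans wV VU.
have [|y yker ->] := Ux u; first by rewrite /= inE.
exists (fun i => if i \in u then y i else 0) => [i _|].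
  by case: ifPn => [/yker //|_]; exact: (ideal0 (proj_ker X i)).
rewrite -big_mkcondr /=; apply: eq_bigl => i.
by case: (boolP (i \in u)) => [/(fintype.subsetP uw)->|]; rewrite ?andbF.
Qed.

Lemma familyHom_idealR (X Y : family) (f : familyHom X Y) l x :
  idealR X l x -> idealR Y l (totalHom f x).
Proof.
move=> Rx u ul; have [y yker ->] := Rx u ul.
exists (fun i => totalHom f (y i)) => [i iu|]; last by rewrite rmorph_sum.
by rewrite /= familyHomP (yker i iu : proj X i (y i) = 0) rmorph0.
Qed.

Definition quot_presheaf_res (X : family) (U V : opens (projZ2 N))
    (VU : V `<=` U) :
    algHom (quot (idealR X (openL U)) : pzAlgType k)
           (quot (idealR X (openL V)) : pzAlgType k) :=
  @quot_map k _ _ _ _ (idAlg (total X)) (@idealR_subset X U V VU).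

Let resE X (U V : opens (projZ2 N)) (VU : V `<=` U) x :
  quot_map_fun (idealR X (openL V)) (idAlg (total X)) (\pi_(quot (idealR X (openL U))) x)
  = \pi_(quot (idealR X (openL V))) x.
Proof. exact: (quot_map_funE (f := idAlg _) (@idealR_subset X U V VU)). Qed.

Let mapE X Y (f : familyHom X Y) l x :
  quot_map_fun (idealR Y l) (totalHom f) (\pi_(quot (idealR X l)) x)
  = \pi_(quot (idealR Y l)) (totalHom f x).
Proof. exact: (quot_map_funE (@familyHom_idealR X Y f l)). Qed.

Program Definition quot_presheaf (X : family) : presheafC k (projZ2 N) :=
  @Functor (opC (opensC (projZ2 N))) (algC k)
    (fun U : opens (projZ2 N) => quot (idealR X (openL U)) : pzAlgType k)
    (fun U V VU => @quot_presheaf_res X U V VU) _ _.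
Next Obligation.
by move=> X U; apply: algHom_ext; elim/quot_ind=> x; rewrite /= quot_map_funE.
Qed.
Next Obligation.
move=> X U V W WV VU; apply: algHom_ext; elim/quot_ind=> x /=.
rewrite (resE VU) (resE WV); exact: (resE (subset_trans WV VU)).
Qed.

Program Definition quot_presheaf_map (X Y : family) (f : familyHom X Y) :
    nattrans (quot_presheaf X) (quot_presheaf Y) :=
  @NatTrans _ _ (quot_presheaf X) (quot_presheaf Y)
    (fun U => quot_map (@familyHom_idealR X Y f (openL U))) _.
Next Obligation.
move=> X Y f U V VU; apply: algHom_ext; elim/quot_ind=> x /=.
by rewrite (resE VU) !mapE (resE VU).
Qed.

Program Definition functorF : functor familyC (presheafC k (projZ2 N)) :=
  @Functor familyC (presheafC k (projZ2 N)) quot_presheaf quot_presheaf_map _ _.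
Next Obligation.
move=> X; apply: nattrans_ext => U; apply: algHom_ext.
by elim/quot_ind=> x; rewrite /= quot_map_funE.
Qed.
Next Obligation.
move=> X Y Z g f; apply: nattrans_ext => U; apply: algHom_ext.
elim/quot_ind=> x /=; rewrite !mapE.
apply: (quot_map_funE (f := compAlg (totalHom g) (totalHom f))) => {}x Rx.
by do 2!apply: familyHom_idealR.
Qed.

Lemma chart_open (i : 'I_N) : open (chart i).
Proof.
exists [set chart i]; last by rewrite bigcup_set1.
move=> _ ->; exists [fset chart i]%fset.
  by move=> A /fset1P ->; rewrite inE; exists i.
by rewrite set_fset1 bigcap_set1.
Qed.

Definition chart_opens (i : 'I_N) : opens (projZ2 N) := Opens (chart_open i).

Definition sections_family (S : presheafC k (projZ2 N)) : family :=
  @Family (S (opensT (projZ2 N))) (fun i => S (chart_opens i))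
    (fun i => res S (@subsetT _ (chart i) :
                       chart_opens i `<=` opensT (projZ2 N))).

Program Definition functorG : functor (presheafC k (projZ2 N)) familyC :=
  @Functor (presheafC k (projZ2 N)) familyC sections_family
    (fun S S' t => @FamilyHom (sections_family S) (sections_family S')
       (ntapp t (opensT (projZ2 N))) (fun i => ntapp t (chart_opens i)) _) _ _.
Next Obligation.
move=> S S' t i x.
exact: (esym (congr1 (fun h : algHom _ _ => h x) (ntapp_nat t _))).
Qed.
Next Obligation. by move=> S; exact: familyHom_ext. Qed.
Next Obligation. by move=> S S' S'' t s; exact: familyHom_ext. Qed.

End Coverings.

(* Main.v *)
(** Opens of [projZ2 N] are the up-closed sets of nonempty subsets [w] of
    [{1..N}], the least open containing [w] being the intersection of the charts
    [A_i], [i \in w].  Hence [idealR X (openL U)] is the intersection of all the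
    sums [\sum_(i in w) ker pi_i] with [w] in [U], not just the minimal ones.

    For a covering, compatible sections of the quotients amount to elements
    [b_w] of [P], for [w] in [U], such that [b_v - b_w] lies in the sum of
    the ideals attached to [v] and [w]; in a distributive lattice of ideals the
    Chinese remainder theorem for finitely many ideals glues them.

    For a flabby sheaf, the kernels [K_U] of the restrictions of global sections
    satisfy [K_(U `|` V) = K_U `&` K_V] and [K_(U `&` V) = K_U + K_V], so they
    inherit distributivity from the opens, and [K_U] is [idealR (openL U)].  Both
    natural isomorphisms are instances of [A / ker f] being the image of [f]. *)
From mathcomp Require Import all_boot all_algebra finmap.
From mathcomp Require Import all_classical topology.
Require Import Defs.

Set Implicit Arguments.
Unset Strict Implicit.
Unset Printing Implicit Defensive.

Import GRing.Theory.

Local Open Scope classical_set_scope.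
Local Open Scope ring_scope.
Local Open Scope quotient_scope.

(** * Factoring a homomorphism through a surjection *)

Section Factor.
Variables (k : pzRingType) (A B C : pzAlgType k).
Variables (f : algHom A B) (g : algHom A C).
Hypothesis f_surj : set_surj [set: A] [set: B] f.
Hypothesis ker_sub : forall x, f x = 0 -> g x = 0.

(** A preimage of [y] is chosen; [ker_sub] makes the value independent of the choice. *)
Definition factor_fun (y : B) : C :=
  g (s2val (cid2 (f_surj I : (f @` setT) y))).

Lemma factor_funE x : factor_fun (f x) = g x.
Proof.
rewrite /factor_fun; case: cid2 => z _ /= fz.
apply/eqP; rewrite -subr_eq0 -rmorphB; apply/eqP/ker_sub.
by rewrite rmorphB /= fz subrr.
Qed.

Fact factor_additive : zmod_morphism factor_fun.
Proof.
move=> x y; have [x' _ <-] := f_surj (I : setT x).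
have [y' _ <-] := f_surj (I : setT y).
by rewrite -rmorphB !factor_funE rmorphB.
Qed.

Fact factor_multiplicative : monoid_morphism factor_fun.
Proof.
split=> [|x y]; first by rewrite -(rmorph1 f) factor_funE rmorph1.
have [x' _ <-] := f_surj (I : setT x); have [y' _ <-] := f_surj (I : setT y).
by rewrite -rmorphM !factor_funE rmorphM.
Qed.

Fact factor_scalable (c : k) y :
  factor_fun (ascale c y) = ascale c (factor_fun y).
Proof.
have [x _ <-] := f_surj (I : setT y).
by rewrite -algHomZ !factor_funE algHomZ.
Qed.

Definition factor : algHom B C :=
  AlgHom factor_additive factor_multiplicative factor_scalable.

Lemma factorE x : factor (f x) = g x. Proof. exact: factor_funE. Qed.

End Factor.

(** * Isomorphism criterion and quotient projections for algebras *)

Section AlgebraMorphismTheory.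
Variable k : pzRingType.

Lemma eq_algHom_surj (A B C : pzAlgType k) (f : algHom A B) (g h : algHom B C) :
  set_surj [set: A] [set: B] f -> (forall x, g (f x) = h (f x)) -> g = h.
Proof.
move=> f_surj gh; apply: algHom_ext => y.
by have [x _ <-] := f_surj y I; exact: gh.
Qed.

Lemma factor_surj (A B C : pzAlgType k) (f : algHom A B) (g : algHom A C)
    (f_surj : set_surj [set: A] [set: B] f)
    (fg : forall x, f x = 0 -> g x = 0) :
  set_surj [set: A] [set: C] g ->
  set_surj [set: B] [set: C] (factor f_surj fg).
Proof.
move=> g_surj z _; have [x _ <-] := g_surj z I.
by exists (f x); rewrite ?factorE.
Qed.

Lemma factor_eq0 (A B C : pzAlgType k) (f : algHom A B) (g : algHom A C)
    (f_surj : set_surj [set: A] [set: B] f)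
    (fg : forall x, f x = 0 -> g x = 0) :
  (forall x, g x = 0 -> f x = 0) -> forall y, factor f_surj fg y = 0 -> y = 0.
Proof.
by move=> gf y; have [x _ <-] := f_surj y I; rewrite factorE => /gf.
Qed.

(** The inverse is the identity of [A] factored through [f]. *)
Lemma algHom_iso (A B : pzAlgType k) (f : algHom A B) :
  set_surj [set: A] [set: B] f -> (forall x, f x = 0 -> x = 0) ->
  is_iso (f : @hom (algC k) A B).
Proof.
move=> f_surj f_inj; pose g := factor (g := idAlg A) f_surj f_inj.
have gf : compAlg g f = idAlg A by apply: algHom_ext => x; exact: factorE.
exists g; split=> //; apply: (eq_algHom_surj f_surj) => x.
exact: (congr1 (fun h : algHom A A => f (h x)) gf).
Qed.

Fact pi_quot_additive (A : pzAlgType k) (I : ideal A) :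
  zmod_morphism (\pi_(quot I) : A -> quot I).
Proof. by move=> x y; rewrite quotN quotD. Qed.

Fact pi_quot_multiplicative (A : pzAlgType k) (I : ideal A) :
  monoid_morphism (\pi_(quot I) : A -> quot I).
Proof. by split=> // x y; rewrite quotM. Qed.

Fact pi_quot_scalable (A : pzAlgType k) (I : ideal A) (c : k) x :
  \pi_(quot I) (ascale c x) = ascale c (\pi_(quot I) x).
Proof. by rewrite quotZ. Qed.

Definition pi_quot (A : pzAlgType k) (I : ideal A) :
    algHom A (quot I : pzAlgType k) :=
  AlgHom (@pi_quot_additive A I) (@pi_quot_multiplicative A I)
    (@pi_quot_scalable A I).

Lemma pi_quot_surj (A : pzAlgType k) (I : ideal A) :
  set_surj [set: A] [set: quot I] (pi_quot I).
Proof. by elim/quot_ind=> x _; exists x. Qed.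

Lemma pi_quot_eq0 (A : pzAlgType k) (I : ideal A) x : pi_quot I x = 0 <-> I x.
Proof. by rewrite -{2}[x]subr0; exact: quot_eqP. Qed.

End AlgebraMorphismTheory.

(** * Componentwise isomorphisms of functors and of families *)

Lemma functor_iso (C D : category) (F G : functorC C D) (s : nattrans F G) :
  (forall X, is_iso (s X)) -> is_iso (s : @hom (functorC C D) F G).
Proof.
move=> s_iso; pose t X := sval (cid (s_iso X)).
have tP X : comp (t X) (s X) = idm _ /\ comp (s X) (t X) = idm _.
  exact: svalP (cid (s_iso X)).
(* Pointwise inverses are automatically natural: insert [comp (s X) (t X)] on the right and use the
   naturality of [s]. *)
have t_nat (X Y : C) (f : hom X Y) :
    comp (t Y) (fmap G f) = comp (fmap F f) (t X).
  rewrite -[LHS]compm1 -(tP X).2 [comp _ (comp (s X) _)]compA.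
  rewrite -[comp (comp (t Y) _) (s X)]compA -ntapp_nat.
  by rewrite [comp (t Y) _]compA (tP Y).1 comp1m.
exists (NatTrans t_nat); split; apply: nattrans_ext => X; first exact: (tP X).1.
exact: (tP X).2.
Qed.

Section FamilyTheory.
Variables (k : fieldType) (N : nat).

Lemma family_iso (X Y : familyC k N) (f : familyHom X Y) :
  is_iso (totalHom f : @hom (algC k) (total X) (total Y)) ->
  (forall i, is_iso (partHom f i : @hom (algC k) (part X i) (part Y i))) ->
  is_iso (f : @hom (familyC k N) X Y).
Proof.
move=> [g [gf fg]] f_iso; pose h i := sval (cid (f_iso i)).
have hP i : compAlg (h i) (partHom f i) = idAlg _ /\
            compAlg (partHom f i) (h i) = idAlg _.
  exact: svalP (cid (f_iso i)).
have homE (A B : pzAlgType k) (u : algHom A B) (v : algHom B A) x :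
  compAlg u v = idAlg B -> u (v x) = x.
  by move/(congr1 (fun w : algHom B B => w x)).
have ghP i x : proj X i (g x) = h i (proj Y i x).
  rewrite -{2}(homE _ _ _ _ x fg) familyHomP.
  exact/esym/homE/(hP i).1.
exists (@FamilyHom k N Y X g h ghP).
by split; apply: familyHom_ext => // i; [exact: (hP i).1 | exact: (hP i).2].
Qed.

(** Surjective projections let the total homomorphism determine the others, so naturality of the
    unit is checked on total algebras only. *)
Lemma eq_familyHom_surj (X Y : family k N)
    (f g : familyHom X Y) :
  (forall i, set_surj [set: total X] [set: part X i] (proj X i)) ->
  totalHom f = totalHom g -> f = g.
Proof.
move=> proj_surj fg; apply: familyHom_ext => // i.
by apply: (eq_algHom_surj (proj_surj i)) => x; rewrite -!familyHomP fg.
Qed.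

End FamilyTheory.

(** * Sums of ideals and the Chinese remainder theorem *)

Section Ideals.
Variables (k : fieldType) (A : pzAlgType k).

Section SumIdeal.
Variables (J : finType) (I_ : J -> ideal A).

Lemma sum_idealS (u v : {set J}) :
  u \subset v -> sum_ideal I_ u `<=` sum_ideal I_ v.
Proof.
move=> /fintype.subsetP uv _ [y Iy ->].
exists (fun i => if i \in u then y i else 0) => [i _|].
  by case: ifPn => [/Iy //|_]; exact: ideal0.
rewrite -big_mkcondr /=; apply: eq_bigl => i.
by case: (boolP (i \in u)) => [/uv->|]; rewrite ?andbF.
Qed.

Lemma sum_ideal0 : sum_ideal I_ finset.set0 = [set 0] :> set A.
Proof.
apply/seteqP; split=> [x [y _ ->]|_ ->]; first by rewrite big_set0.
exact: ideal0.
Qed.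

Lemma sum_ideal1 i : sum_ideal I_ [set i]%SET = I_ i :> set A.
Proof.
apply/seteqP; split=> [x [y Iy ->]|x Ix].
  by rewrite big_set1; apply: Iy; rewrite inE.
by exists (fun=> x) => [j /set1P->//|]; rewrite big_set1.
Qed.

Lemma sum_idealU (u v : {set J}) :
  sum_ideal I_ (u :|: v)%SET =
  add_ideals (sum_ideal I_ u) (sum_ideal I_ v) :> set A.
Proof.
apply/seteqP; split=> [x [y Iy ->]|_ [x ux] [y vy] <-]; last first.
  by apply: idealD; [apply: sum_idealS ux; exact: finset.subsetUl
                    |apply: sum_idealS vy; exact: finset.subsetUr].
exists (\sum_(i in u) y i).
  by exists y => // i iu; apply: Iy; rewrite inE iu.
(* Removing [u] keeps the overlap from being counted twice. *)
exists (\sum_(i in (v :\: u)%SET) y i).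
  apply: (@sum_idealS (v :\: u)%SET v); first exact: finset.subsetDl.
  by exists y => // i /setDP[iv _]; apply: Iy; rewrite inE iv orbT.
rewrite [RHS](big_setID u) /= finset.setUK.
by congr (_ + _); apply: eq_bigl => i; rewrite !inE; case: (i \in u).
Qed.

End SumIdeal.

Section ChineseRemainder.
Variable L : set (set A).
Hypotheses (L_sub : sublattice L) (L_distr : distributive_lattice L).

(** The dual distributive law: expand the left side over [I + K], whose first part falls in [I],
    then expand [K] against [I + J]. *)
Lemma add_ideals_cap (I : ideal A) (J K : set A) : L I -> L J -> L K ->
  add_ideals I J `&` add_ideals I K `<=` add_ideals I (J `&` K).
Proof.
move=> LI LJ LK; have [LIJ _] := L_sub LI LJ.
rewrite L_distr // => _ [x [_ Ix] [y [IJy Ky] <-]].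
have : (K `&` add_ideals I J) y by [].
rewrite L_distr // => -[z [_ Iz] [t [Kt Jt] zt]].
by rewrite -zt; exists (x + z); [exact: idealD | exists t; rewrite ?addrA].
Qed.

Lemma add_ideals_bigcap (T : choiceType) (F : T -> set A) (s : seq T)
    (I : ideal A) y :
  L I -> {in s, forall t, L (F t)} ->
  {in s, forall t, add_ideals I (F t) y} ->
  add_ideals I (\bigcap_(t in [set` s]) F t) y.
Proof.
move=> LI LF Iy.
(* The induction must carry membership in [L], except for the empty intersection: the whole algebra
   need not belong to [L]. *)
suff [[->|_]//] : (s = [::] \/ L (\bigcap_(t in [set` s]) F t)) /\
    add_ideals I (\bigcap_(t in [set` s]) F t) y.
elim: s LF Iy => [|t s IHs] LF Iy.
  split; first by left.
  by exists 0; [exact: ideal0 | exists y; rewrite ?add0r].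
have LFt : L (F t) by apply: LF; rewrite mem_head.
have Iyt : add_ideals I (F t) y by apply: Iy; rewrite mem_head.
have [|u us|LFs Iys] := IHs.
- by move=> u us; apply: LF; rewrite inE us orbT.
- by apply: Iy; rewrite inE us orbT.
rewrite bigcap_seq big_cons -bigcap_seq.
case: LFs => [->|LFs].
  by rewrite bigcap_seq big_nil setIT; split; [right|].
split; first by right; have [] := L_sub LFt LFs.
exact: add_ideals_cap.
Qed.

(** A solution [x] for [s] is corrected by some [q] common to all [F u] with [u] in [s], where
    [a t - x = p + q] and [p] is in [F t]. *)
Lemma chinese_remainder (T : choiceType) (F : T -> ideal A) (s : seq T)
    (a : T -> A) :
  {in s, forall t, L (F t)} ->
  {in s &, forall t u, add_ideals (F t) (F u) (a t - a u)} ->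
  exists x, {in s, forall t, F t (x - a t)}.
Proof.
elim: s => [|t s IHs] LF Fa; first by exists 0.
have [|u v us vs|x xP] := IHs.
- by move=> u us; apply: LF; rewrite inE us orbT.
- by apply: Fa; rewrite inE ?us ?vs orbT.
have [||u us|p Fp [q Fq pq]] :=
  @add_ideals_bigcap T (fun t => F t) s (F t) (a t - x).
- by apply: LF; rewrite mem_head.
- by move=> u us; apply: LF; rewrite inE us orbT.
(* Here [a t - x] is split as [(a t - a u) - (x - a u)]. *)
- have [||p Fp [q Fq pq]] := Fa t u; rewrite ?mem_head ?inE ?us ?orbT //.
  exists p => //; exists (q - (x - a u)).
    by apply: idealD => //; apply: idealN; exact: xP.
  by rewrite addrA pq opprB subrKA.
exists (x + q) => u /[!inE] /predU1P[->|us].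
  suff -> : x + q - a t = - p by exact: idealN.
  by apply/eqP; rewrite subr_eq -[a t](subrK x) -pq !addrA addNr add0r addrC.
by rewrite addrAC; apply: idealD; [exact: xP | exact: Fq].
Qed.

End ChineseRemainder.

End Ideals.

(** * Points as nonempty index sets, and their least neighbourhoods *)

Section Topology.
Variable N : nat.

Definition chart_cap (w : {set 'I_N}) : set (projZ2 N) :=
  \bigcap_(i in [set` w]) chart i.

Definition supp (z : projZ2 N) : {set 'I_N} := [set i | sval z i]%SET.

Lemma chart_capE w z : chart_cap w z <-> w \subset supp z.
Proof.
split=> [wz|/fintype.subsetP wz i /wz]; last by rewrite inE.
by apply/fintype.subsetP => i /wz; rewrite inE.
Qed.

Lemma supp_neq0 z : supp z != finset.set0.
Proof.
apply: contra (svalP z) => /eqP z0; apply/eqP/ffunP => i.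
by have /setP/(_ i) := z0; rewrite !inE ffunE.
Qed.

Lemma supp_surj w : w != finset.set0 -> exists z, supp z = w.
Proof.
move=> w0.
have zP : [ffun i => i \in w] != [ffun=> false] :> {ffun 'I_N -> bool}.
  apply: contra w0 => /eqP/ffunP zw; apply/eqP/setP => i.
  by have := zw i; rewrite !ffunE inE.
exists (exist (fun z : {ffun 'I_N -> bool} => z != [ffun=> false]) _ zP).
by apply/setP => i; rewrite inE /= ffunE.
Qed.

Lemma chart_cap_open w : open (chart_cap w).
Proof.
have -> : chart_cap w = \bigcap_(i in [set` enum w]) chart i.
  by congr bigcap; apply/seteqP; split=> i /=; rewrite mem_enum.
rewrite bigcap_seq; apply: (big_ind open) => [||i _].
- exact: openT.
- exact: openI.
- exact: chart_open.
Qed.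

Definition chart_cap_opens w : opens (projZ2 N) := Opens (chart_cap_open w).

(** Some finite intersection of charts contains [z] and lies in [U]; each of these charts also
    contains every point whose support contains that of [z]. *)
Lemma chart_cap_supp_sub (U : opens (projZ2 N)) z :
  open_set U z -> chart_cap (supp z) `<=` U.
Proof.
case: U => _ /= [B BI <-] [_ /[dup] /BI [C CI <-] BC Cz] y /chart_capE zy.
exists (\bigcap_(i in [set` C]) i) => //.
suff : (\bigcap_(i in [set` C]) i) y by [].
move=> D DC; have [i _ iD] : range (@chart N) D by have := CI _ DC; rewrite inE.
have := Cz _ DC; rewrite -iD /chart /= => zi.
by have /fintype.subsetP/(_ i) := zy; rewrite !inE; exact.
Qed.

Lemma chart_capU v w : chart_cap (v :|: w)%SET = chart_cap v `&` chart_cap w.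
Proof.
apply/seteqP; split=> z.
  move=> /chart_capE; rewrite finset.subUset => /andP[? ?].
  by split; apply/chart_capE.
move=> [/chart_capE vz /chart_capE wz]; apply/chart_capE.
by rewrite finset.subUset vz.
Qed.

Lemma chart_cap_supp z : chart_cap (supp z) z.
Proof. exact/chart_capE. Qed.

End Topology.

(** * From coverings to flabby sheaves *)

Section CoveringToSheaf.
Variables (k : fieldType) (N : nat).

(** The support of a point of [U] contains a minimal element of the index family, with a smaller
    sum; conversely each minimal element is the support of a point of [U]. *)
Lemma idealR_openP (X : family k N) (U : opens (projZ2 N)) x :
  idealR X (openL U) x <->
  forall z, open_set U z -> sum_ideal (proj_ker X) (supp z) x.
Proof.
split=> [Rx z Uz|Ux w].
  have [|u uU uz] := @minset_exists _ (fun w : {set 'I_N} =>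
      (w != finset.set0) && `[< chart_cap w `<=` U >]) (supp z).
    by rewrite supp_neq0; apply/asboolP; exact: chart_cap_supp_sub.
  by apply: sum_idealS uz _ _; apply: Rx; rewrite /= inE.
rewrite /= inE => /minsetp /andP[/supp_surj[z <-] /asboolP zU].
by apply: Ux; apply: zU; exact: chart_cap_supp.
Qed.

Lemma sublattice_ker_lattice (X : family k N) : sublattice (@ker_lattice k N X).
Proof.
move=> I J LI LJ; split=> M [M_sub MX];
by have [] := M_sub _ _ (LI _ (conj M_sub MX)) (LJ _ (conj M_sub MX)).
Qed.

Lemma ker_lattice_sum_ideal (X : family k N) (w : {set 'I_N}) :
  w != finset.set0 -> @ker_lattice k N X (sum_ideal (proj_ker X) w).
Proof.
have [n] := ubnP #|w|; elim: n w => // n IHn w /ltnSE wn /set0Pn[i iw].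
have LI : @ker_lattice k N X (proj_ker X i).
  by apply: sub_gen_smallest; exists i.
rewrite -(finset.setD1K iw) sum_idealU sum_ideal1.
(* Singletons are treated apart: the empty sum is the zero ideal, which need not lie in the lattice
   of an arbitrary family. *)
have [->|wi0] := eqVneq (w :\ i)%SET finset.set0.
  rewrite sum_ideal0.
  suff -> : add_ideals (proj_ker X i) [set 0] = proj_ker X i by [].
  apply/seteqP; split=> [_ [x ix] [_ -> <-]|x ix]; first by rewrite addr0.
  by exists x => //; exists 0; rewrite ?addr0.
apply: (sublattice_ker_lattice LI _).1; apply: IHn => //.
by apply: leq_trans wn; rewrite [leqRHS](cardsD1 i) iw.
Qed.

Lemma functorF_resE (X : family k N) (U V : opens (projZ2 N))
    (VU : V `<=` U) x :
  res (functorF k N X) VU (pi_quot (idealR X (openL U)) x) =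
  pi_quot (idealR X (openL V)) x.
Proof. exact: (quot_mapE (f := idAlg _) (@idealR_subset k N X U V VU)). Qed.

Lemma functorF_flabby (X : family k N) : is_flabby (functorF k N X).
Proof.
move=> U V VU y _; have [x _ <-] := @pi_quot_surj k _ (idealR X (openL V)) y I.
by exists (pi_quot (idealR X (openL U)) x) => //; exact: functorF_resE.
Qed.

Lemma functorF_sheaf (X : family k N) :
  is_covering X -> is_sheaf (functorF k N X).
Proof.
case=> _ _ L_distr U J V VU UV s s_compat.
have /choice[a aP] :
    forall j, exists x, pi_quot (idealR X (openL (V j))) x = s j.
  move=> j; have [x _ <-] := @pi_quot_surj k _ (idealR X _) (s j) I.
  by exists x.
have a_compat i j z : open_set (V i) z -> open_set (V j) z ->
    sum_ideal (proj_ker X) (supp z) (a i - a j).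
  move=> iz jz; move: (s_compat i j); rewrite -!aP !functorF_resE.
  by move=> /quot_eqP/idealR_openP; apply.
(* The cover may be infinite but the space is finite, so one lift is chosen per point; the value [0]
   outside [U] is a dummy. *)
have /choice[b bP] : forall z, exists x, open_set U z ->
    exists2 j, open_set (V j) z & x = a j.
  move=> z; have [/UV[j _ jz]|nUz] := pselect (open_set U z); last by exists 0.
  by exists (a j) => _; exists j.
pose F z := sum_ideal (proj_ker X) (supp z).
pose pts : seq (projZ2 N) := [seq z <- enum {: projZ2 N} | `[< open_set U z >]].
have [z|z t|x xP] := chinese_remainder (@sublattice_ker_lattice X) L_distr
    (F := F) (s := pts) (a := b).
- by move=> _; apply: ker_lattice_sum_ideal; exact: supp_neq0.
- rewrite !mem_filter => /andP[/asboolP Uz _] /andP[/asboolP Ut _].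
  have [i iz ->] := bP z Uz; have [j jt ->] := bP t Ut.
  (* The point [y] lies in both [V i] and [V j] because opens are up-closed; compatibility at [y] is
     the congruence modulo the sum of the two ideals. *)
  have [y yzt] : exists y, supp y = (supp z :|: supp t)%SET.
    apply: supp_surj; rewrite -finset.subset0 finset.subUset finset.subset0.
    by rewrite (negPf (supp_neq0 z)).
  rewrite /F -sum_idealU -yzt; apply: a_compat.
    apply: (chart_cap_supp_sub iz); apply/chart_capE.
    by rewrite yzt finset.subsetUl.
  apply: (chart_cap_supp_sub jt); apply/chart_capE.
  by rewrite yzt finset.subsetUr.
exists (pi_quot (idealR X (openL U)) x); split=> [j|y].
  rewrite functorF_resE -aP; apply/quot_eqP/idealR_openP => z jz.
  have Uz := VU j _ jz.
  have [i iz bi] := bP z Uz.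
  (* The index [i] chosen at [z] may differ from [j]; compatibility at [z] bridges the two. *)
  rewrite -(subrK (a i) x) -addrA; apply: idealD; last exact: a_compat.
  by rewrite -bi; apply: xP; rewrite mem_filter mem_enum andbT; exact/asboolP.
(* Uniqueness: at each point of [U], both [x] and [y] are congruent to the chosen lift [a i]. *)
elim/quot_ind: y => y yP; apply/quot_eqP/idealR_openP => z Uz.
have [i iz bi] := bP z Uz.
have : sum_ideal (proj_ker X) (supp z) (a i - y).
  move: z iz {Uz bi}; apply/idealR_openP/quot_eqP.
  by rewrite [LHS]aP -(yP i); exact: functorF_resE.
have : F z (x - b z).
  by apply: xP; rewrite mem_filter mem_enum andbT; exact/asboolP.
by rewrite bi => Fx Fy; rewrite -(subrK (a i) x) -addrA; exact: idealD.
Qed.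

End CoveringToSheaf.

(** * Kernels of restriction of global sections *)

Section ResKer.
Variables (k : fieldType) (T : topologicalType) (S : presheafC k T).

Definition opens_subT (U : opens T) : U `<=` opensT T := @subsetT T U.

Definition res_ker (U : opens T) : ideal (S (opensT T)) :=
  ker_ideal (res S (@opens_subT U)).

(** The proof [WU] is left arbitrary so that rewriting does not depend on how an inclusion was
    proved. *)
Lemma res_comp (U V W : opens T) (VU : V `<=` U) (WV : W `<=` V)
    (WU : W `<=` U) x :
  res S WV (res S VU x) = res S WU x.
Proof.
rewrite (Prop_irrelevance WU (subset_trans WV VU)).
have := @fmap_comp _ _ S U V W WV VU.
by move/(congr1 (fun h : algHom (S U) (S W) => h x)).
Qed.

Lemma res_id (U : opens T) (UU : U `<=` U) x : res S UU x = x.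
Proof.
rewrite (Prop_irrelevance UU (@subset_refl T U)).
by have /(congr1 (fun h : algHom (S U) (S U) => h x)) := @fmap1 _ _ S U.
Qed.

Lemma res_kerS (U V : opens T) : V `<=` U -> res_ker U `<=` res_ker V.
Proof.
move=> VU x /= xU; rewrite -(res_comp (@opens_subT U) VU) xU; exact: rmorph0.
Qed.

Hypotheses (S_sheaf : is_sheaf S) (S_flabby : is_flabby S).

(** Separatedness: [0] and the restriction of [x] to [U] both glue the family of zero sections. *)
Lemma res_ker_bigcup (U : opens T) (J : Type) (V : J -> opens T) x :
  (forall j, V j `<=` U) -> U `<=` \bigcup_j V j ->
  (forall j, res_ker (V j) x) -> res_ker U x.
Proof.
move=> VU UV xV; have [|y [_ y_uniq]] := S_sheaf VU UV (s := fun=> 0).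
  by move=> i j; rewrite !rmorph0.
rewrite /= -(y_uniq 0) => [|j]; last exact: rmorph0.
by apply/esym/y_uniq => j; rewrite (res_comp _ _ (@opens_subT _)); exact: xV.
Qed.

Definition opensU (U V : opens T) : opens T :=
  Opens (openU (openP U) (openP V)).

Lemma opens_ext (U V : opens T) : U = V :> set T -> U = V.
Proof.
case: U V => [U Uo] [V Vo] /= UV; case: V / UV Vo => Vo.
by congr Opens; exact: Prop_irrelevance.
Qed.

Let bool_opens (U V : opens T) (b : bool) := if b then U else V.

Let sub_bool_opens U V b : bool_opens U V b `<=` opensU U V.
Proof. by case: b; [exact: subsetUl | exact: subsetUr]. Qed.

Let bool_opens_cover U V : opensU U V `<=` \bigcup_b bool_opens U V b.
Proof. by move=> z [Uz|Vz]; [exists true | exists false]. Qed.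

Lemma res_kerU (U V : opens T) :
  res_ker (opensU U V) = res_ker U `&` res_ker V :> set _.
Proof.
apply/seteqP; split=> [x xUV|x [xU xV]].
  by split; apply: res_kerS xUV => z Uz; [left | right].
apply: (res_ker_bigcup (@sub_bool_opens U V) (@bool_opens_cover U V)).
by case.
Qed.

(* A section vanishing on [U `&` V] is glued, on [U `|` V], from [0] on [U] and
   itself on [V]; a global extension of the result lies in [res_ker U] and
   differs from the given section by an element of [res_ker V]. *)
Lemma res_kerI (U V : opens T) :
  res_ker (opensI U V) = add_ideals (res_ker U) (res_ker V) :> set _.
Proof.
apply/seteqP; split=> [x xUV|_ [x xU] [y yV] <-]; last first.
  apply: idealD; first by apply: (res_kerS _ xU) => z [].
  by apply: (res_kerS _ yV) => z [].
pose g (b : bool) := if b then 0 else x.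
pose s b := res S (@opens_subT (bool_opens U V b)) (g b).
have [|y [yP _]] :=
  S_sheaf (@sub_bool_opens U V) (@bool_opens_cover U V) (s := s).
  move=> b c; rewrite /s !(res_comp _ _ (@opens_subT _)).
  have xVU : res S (@opens_subT (opensI V U)) x = 0.
    by apply: (res_kerS _ xUV) => z [].
  by case: b; case: c; rewrite /= ?rmorph0.
have [z _ zy] := S_flabby (@opens_subT (opensU U V)) (I : setT y).
exists z.
  by have := yP true; rewrite -zy (res_comp _ _ (@opens_subT _)) /s /= rmorph0.
exists (x - z); last by rewrite addrC subrK.
have := yP false; rewrite -zy (res_comp _ _ (@opens_subT _)) /s /= => zx.
by rewrite /= rmorphB /= zx subrr.
Qed.

End ResKer.

(** * From flabby sheaves to coverings *)

Section SheafToCovering.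
Variables (k : fieldType) (N : nat) (S : presheafC k (projZ2 N)).
Hypotheses (S_sheaf : is_sheaf S) (S_flabby : is_flabby S).

Lemma res_kerT : res_ker S (opensT (projZ2 N)) = [set 0] :> set _.
Proof.
by apply/seteqP; split=> [x|_ ->]; [rewrite /= res_id | exact: ideal0].
Qed.

Lemma functorG_covering : is_covering (functorG k N S).
Proof.
split=> [i y _||I J K].
- have [x _ <-] := S_flabby (@opens_subT _ (chart_opens i)) (I : setT y).
  by exists x.
- rewrite -res_kerT; apply/seteqP; split=> [x x0|x].
    apply: (res_ker_bigcup S_sheaf (V := @chart_opens N)) => [//|z _|i].
      (* The charts cover the space, since supports are nonempty. *)
      by have /set0Pn[i] := supp_neq0 z; rewrite inE; exists i.
    exact: x0.
  by rewrite res_kerT => -> i _; exact: ideal0.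
(* The kernels of all restrictions form a sublattice containing the generators, hence the generated
   lattice. *)
pose L := [set M | exists U, M = res_ker S U :> set _].
have LP : @ker_lattice k N (functorG k N S) `<=` L.
  apply: smallest_sub => [M M' [U ->] [V ->]|_ [i _ <-]]; last first.
    by exists (chart_opens i).
  split; first by exists (opensI U V); rewrite -res_kerI.
  by exists (opensU U V); rewrite -res_kerU.
move=> /LP[U ->] /LP[V ->] /LP[W ->].
rewrite -(res_kerI S_sheaf S_flabby) -!(res_kerU S_sheaf) -res_kerI //.
(* Taking kernels turns unions into intersections and intersections into sums, so what remains is
   distributivity of union over intersection. *)
by congr (res_ker S _ : set _); apply: opens_ext; rewrite /= setUIr.
Qed.

(** By induction on [w], [res_kerI] turns each further intersection with a chart into a sum. The
    empty intersection is the whole space, with kernel zero, the empty sum. *)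
Lemma res_ker_chart_cap (w : {set 'I_N}) :
  res_ker S (chart_cap_opens w) =
  sum_ideal (proj_ker (functorG k N S)) w :> set _.
Proof.
have [n] := ubnP #|w|; elim: n w => // n IHn w /ltnSE wn.
have [->|/set0Pn[i iw]] := eqVneq w finset.set0.
  rewrite sum_ideal0 -res_kerT; congr (res_ker S _ : set _); apply: opens_ext.
  by apply/seteqP; split=> z // _; apply/chart_capE; exact: finset.sub0set.
rewrite -(finset.setD1K iw) sum_idealU sum_ideal1 -IHn; last first.
  by apply: leq_trans wn; rewrite [leqRHS](cardsD1 i) iw.
rewrite -[proj_ker _ i]/(res_ker S (chart_opens i)) -res_kerI //.
congr (res_ker S _ : set _); apply: opens_ext.
by rewrite /= chart_capU; congr (_ `&` _); apply/seteqP; split=> z;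
   [move=> /chart_capE; rewrite finset.sub1set inE
   |move=> zi; apply/chart_capE; rewrite finset.sub1set inE].
Qed.

(** [U] is covered by the least neighbourhoods of its points, whose kernels are the sums in
    [idealR_openP]. *)
Lemma res_ker_idealR (U : opens (projZ2 N)) x :
  res_ker S U x <-> idealR (functorG k N S) (openL U) x.
Proof.
split=> [Ux|/idealR_openP Ux].
  apply/idealR_openP => z Uz; rewrite -res_ker_chart_cap.
  apply: (@res_kerS _ _ S U (chart_cap_opens (supp z))) Ux.
  exact: chart_cap_supp_sub.
apply: (@res_ker_bigcup _ _ S S_sheaf U {z | open_set U z}
    (fun z => chart_cap_opens (supp (sval z)))).
- by case=> z Uz; exact: chart_cap_supp_sub.
- by move=> z Uz; exists (exist _ z Uz) => //; exact: chart_cap_supp.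
- by case=> z Uz; rewrite res_ker_chart_cap; exact: Ux.
Qed.

End SheafToCovering.

(** * The unit: a covering against the sections of its sheaf *)

Section Unit.
Variables (k : fieldType) (N : nat).

(** The point with support [{i}] gives the smallest of the sums to be intersected, namely the kernel
    of [proj X i]. *)
Lemma idealR_chart (X : family k N) (i : 'I_N) x :
  idealR X (openL (chart i)) x <-> proj X i x = 0.
Proof.
rewrite (idealR_openP (chart_opens i)); split=> [Xx|ix z zi].
  have [|z zi] := @supp_surj N [set i]%SET.
    by apply/set0Pn; exists i; rewrite inE.
  have := Xx z; rewrite zi sum_ideal1; apply.
  by rewrite /= /chart /=; have := set11 i; rewrite -zi inE.
have : sum_ideal (proj_ker X) [set i]%SET x by rewrite sum_ideal1.
by apply: sum_idealS; rewrite finset.sub1set inE.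
Qed.

Lemma idealR_setT (X : family k N) x :
  is_covering X -> idealR X (openL setT) x -> x = 0.
Proof.
move=> [_ ker0 _] Xx; suff : [set 0] x by [].
rewrite -ker0 => i _; apply/idealR_chart.
by apply: idealR_subset Xx; exact: subsetT.
Qed.

Section Component.
Variables (X : family k N) (X_cov : is_covering X).

Let proj_surj i : set_surj [set: total X] [set: part X i] (proj X i).
Proof. by case: X_cov. Qed.

Let pi_chart i : algHom (total X) (part (functorG k N (functorF k N X)) i) :=
  pi_quot (idealR X (openL (chart i))).

Let proj_ker_sub i x : proj X i x = 0 -> pi_chart i x = 0.
Proof. by move=> ix; apply/pi_quot_eq0/idealR_chart. Qed.

Fact unit_comm i x :
  proj (functorG k N (functorF k N X)) i (pi_quot (idealR X (openL setT)) x) =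
  factor (@proj_surj i) (@proj_ker_sub i) (proj X i x).
Proof.
by rewrite factorE; exact: (@functorF_resE k N X (opensT _) (chart_opens i)).
Qed.

Definition unit_hom : @hom (familyC k N) X (functorG k N (functorF k N X)) :=
  FamilyHom unit_comm.

Lemma unit_hom_iso : is_iso unit_hom.
Proof.
apply: family_iso => [|i]; apply: algHom_iso.
- exact: pi_quot_surj.
- by move=> x /pi_quot_eq0; exact: idealR_setT.
- by apply: factor_surj; exact: pi_quot_surj.
- by apply: factor_eq0 => x /pi_quot_eq0/idealR_chart.
Qed.

End Component.

Lemma unit_hom_nat (X Y : family k N) (X_cov : is_covering X)
    (Y_cov : is_covering Y) (f : @hom (familyC k N) X Y) :
  comp (unit_hom Y_cov) f =
  comp (fmap (functorG k N) (fmap (functorF k N) f)) (unit_hom X_cov).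
Proof.
have [proj_surj _ _] := X_cov; apply: eq_familyHom_surj => //.
by apply: algHom_ext => x /=; rewrite quot_map_funE //; exact: familyHom_idealR.
Qed.

End Unit.

(** * The counit: quotients of global sections against local sections *)

Section Counit.
Variables (k : fieldType) (N : nat).

Section Component.
Variables (S : presheafC k (projZ2 N)) (S_fs : is_flabby_sheaf S).

Let res_ker_sub (U : opens (projZ2 N)) x :
  pi_quot (idealR (functorG k N S) (openL U)) x = 0 ->
  res S (@opens_subT _ U) x = 0.
Proof. by move=> /pi_quot_eq0/(res_ker_idealR S_fs.1 S_fs.2). Qed.

Definition counit_app (U : opens (projZ2 N)) :
    algHom (functorF k N (functorG k N S) U) (S U) :=
  factor (@pi_quot_surj k _ (idealR (functorG k N S) (openL U)))
    (@res_ker_sub U).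

Lemma counit_appE U x :
  counit_app U (pi_quot (idealR (functorG k N S) (openL U)) x) =
  res S (@opens_subT _ U) x.
Proof. exact: factorE. Qed.

Fact counit_app_nat (U V : opC (opensC (projZ2 N))) (VU : hom U V) :
  @comp (algC k) _ _ _ (counit_app V)
    (fmap (functorF k N (functorG k N S)) VU) =
  comp (fmap S VU) (counit_app U).
Proof.
apply: (eq_algHom_surj (@pi_quot_surj k _ _)) => x.
apply: (etrans (congr1 (counit_app V) (functorF_resE VU x))).
by rewrite counit_appE -(res_comp (@opens_subT _ U) VU) -counit_appE.
Qed.

Definition counit_hom :
    @hom (presheafC k (projZ2 N)) (functorF k N (functorG k N S)) S :=
  NatTrans counit_app_nat.

(** Flabbiness gives surjectivity on each open, and [res_ker_idealR] gives injectivity. *)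
Lemma counit_hom_iso : is_iso counit_hom.
Proof.
apply: functor_iso => U; apply: algHom_iso.
  by apply: factor_surj; exact: S_fs.2.
by apply: factor_eq0 => x Ux; apply/pi_quot_eq0/(res_ker_idealR S_fs.1 S_fs.2).
Qed.

End Component.

Lemma counit_hom_nat (S S' : presheafC k (projZ2 N)) (S_fs : is_flabby_sheaf S)
    (S'_fs : is_flabby_sheaf S') (t : @hom (presheafC k (projZ2 N)) S S') :
  comp (counit_hom S'_fs) (fmap (functorF k N) (fmap (functorG k N) t)) =
  comp t (counit_hom S_fs).
Proof.
apply: nattrans_ext => U.
apply: (eq_algHom_surj (@pi_quot_surj k _ _)) => x.
have tE : fmap (functorF k N) (fmap (functorG k N) t) U (pi_quot _ x) =
    pi_quot (idealR (functorG k N S') (openL U)) (t (opensT _) x).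
  exact: (quot_mapE (@familyHom_idealR _ _ _ _ (fmap (functorG k N) t) _)).
apply: (etrans (congr1 (counit_app S'_fs U) tE)).
rewrite counit_appE.
apply: (etrans _ (congr1 (t U) (esym (counit_appE S_fs U x)))).
(* On classes of global sections, the claim is naturality of [t] along the inclusion of [U] in the
   whole space. *)
have := ntapp_nat t (@opens_subT _ U : @hom (opC (opensC _)) (opensT _) U).
by move/(congr1 (fun h : algHom (S (opensT _)) (S' U) => h x)).
Qed.

End Counit.

Theorem theorem4p5 (k : fieldType) (N : nat) (N_ge1 : (1 <= N)%N) :
  exists (covering_to_flabby : forall X : familyC k N,
            is_covering X -> is_flabby_sheaf (functorF k N X))
         (flabby_to_covering : forall S : presheafC k (projZ2 N),
            is_flabby_sheaf S -> is_covering (functorG k N S)),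
    inverse_equivalences (restrictF covering_to_flabby)
                         (restrictF flabby_to_covering).
Proof.
exists (fun X X_cov => conj (functorF_sheaf X_cov) (@functorF_flabby k N X)).
exists (fun S S_fs => functorG_covering S_fs.1 S_fs.2).
split.
  unshelve eexists.
    by exists (fun X => unit_hom (svalP X)) => X Y f; exact: unit_hom_nat.
  by move=> X; exact: unit_hom_iso.
unshelve eexists.
  by exists (fun S => counit_hom (svalP S)) => S S' t; exact: counit_hom_nat.
by move=> S; exact: counit_hom_iso.
Qed.
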